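(* Let $S$ be a bzi-semiring. An ideal $\mathfrak{p}$ of $S$ is $z$-prime if and only if $\mathfrak{p}$ is a prime $z$-ideal of $S$ (that is, a $z$-ideal that is also a prime ideal).
   Context: A (commutative) semiring is a system $(S,+,0,\cdot,1)$ with $(S,+,0)$ and $(S,\cdot,1)$ commutative monoids, $0s=0$ for all $s\in S$, and multiplication distributing over addition. An ideal of $S$ is a nonempty subset closed under addition and under multiplication by elements of $S$; it is proper if it is not $S$. The product $\mathfrak{a}\mathfrak{b}$ of ideals is the ideal generated by $\{ab\mid a\in\mathfrak{a},b\in\mathfrak{b}\}$. A proper ideal $\mathfrak{p}$ is prime if $ab\in\mathfrak{p}$ implies $a\in\mathfrak{p}$ or $b\in\mathfrak{p}$. $\mathrm{Max}(S)$ is the set of maximal (proper) ideals of $S$, and for $x\in S$, $\mathcal{M}_x=\{\mathfrak{m}\in\mathrm{Max}(S)\mid x\in\mathfrak{m}\}$. An ideal $\mathfrak{z}$ of $S$ is a $z$-ideal if $\bigcap\mathcal{M}_x\subseteq\mathfrak{z}$ for every $x\in\mathfrak{z}$ (the intersection of the empty family is $S$). A basic $z$-ideal is an ideal of the form $\mathsf{m}_x=\bigcap\mathcal{M}_x$, $x\in S$; $S$ is a bzi-semiring if $\mathsf{m}_x\mathsf{m}_x=\mathsf{m}_x$ for all $x\in S$. A proper $z$-ideal $\mathfrak{p}$ is $z$-prime if for all $z$-ideals $\mathfrak{a},\mathfrak{b}$, $\mathfrak{a}\mathfrak{b}\subseteq\mathfrak{p}$ implies $\mathfrak{a}\subseteq\mathfrak{p}$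 or $\mathfrak{b}\subseteq\mathfrak{p}$. *)

(* Defs.v *)
From mathcomp Require Import all_boot all_algebra.
From mathcomp Require Import boolp classical_sets.

Set Implicit Arguments.
Unset Strict Implicit.
Unset Printing Implicit Defensive.

Import GRing.Theory.
Local Open Scope classical_set_scope.
Local Open Scope ring_scope.

(* [comPzSemiRingType] allows 0 = 1, so the zero semiring is included. *)

Definition is_ideal (S : comPzSemiRingType) (A : set S) : Prop :=
  [/\ A !=set0,
      forall a b, A a -> A b -> A (a + b) &
      forall s a, A a -> A (s * a)].

Definition proper_ideal (S : comPzSemiRingType) (A : set S) : Prop :=
  is_ideal A /\ A <> setT.

Definition ideal_gen (S : comPzSemiRingType) (X : set S) : set S :=
  smallest (@is_ideal S) X.

Definition ideal_mul (S : comPzSemiRingType) (A B : set S) : set S :=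
  ideal_gen [set a * b | a in A & b in B].

Definition prime_ideal (S : comPzSemiRingType) (P : set S) : Prop :=
  proper_ideal P /\ forall a b, P (a * b) -> P a \/ P b.

Definition maximal_ideal (S : comPzSemiRingType) (M : set S) : Prop :=
  proper_ideal M /\ forall A, proper_ideal A -> M `<=` A -> A = M.

Definition Max (S : comPzSemiRingType) : set (set S) :=
  [set M | maximal_ideal M].
Arguments Max S : clear implicits.

Definition Max_at (S : comPzSemiRingType) (x : S) : set (set S) :=
  [set M | Max S M /\ M x].

(* A [bigcap] over an empty family is [setT], as required when no maximal
   ideal contains [x]. *)
Definition basic_z (S : comPzSemiRingType) (x : S) : set S :=
  \bigcap_(M in Max_at x) M.

Definition z_ideal (S : comPzSemiRingType) (Z : set S) : Prop :=
  is_ideal Z /\ forall x, Z x -> basic_z x `<=` Z.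

Definition bzi_semiring (S : comPzSemiRingType) : Prop :=
  forall x : S, ideal_mul (basic_z x) (basic_z x) = basic_z x.

Definition z_prime (S : comPzSemiRingType) (P : set S) : Prop :=
  [/\ z_ideal P, P <> setT &
      forall A B, z_ideal A -> z_ideal B ->
        ideal_mul A B `<=` P -> A `<=` P \/ B `<=` P].

(* Main.v *)
Require Import Defs.
From mathcomp Require Import all_boot all_algebra.
From mathcomp Require Import boolp classical_sets.

(** Maximal ideals are prime, so every maximal ideal containing [a * b] contains
    [a] or [b]. Hence the product of the basic z-ideals of [a] and [b] lies in the
    basic z-ideal of [a * b], and a z-prime ideal, tested on these basic z-ideals,
    is prime. *)

Set Implicit Arguments.
Unset Strict Implicit.
Unset Printing Implicit Defensive.

Import GRing.Theory.
Local Open Scope classical_set_scope.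
Local Open Scope ring_scope.

Lemma ideal0 (S : comPzSemiRingType) (A : set S) : is_ideal A -> A 0.
Proof. by case=> -[a Aa] _ /(_ 0 a Aa); rewrite mul0r. Qed.

(** This is the ideal generated by [A] and [a]; it serves to enlarge a maximal ideal by an element
    outside it. *)
Lemma ideal_adjoin (S : comPzSemiRingType) (A : set S) (a : S) :
  is_ideal A -> is_ideal [set x | exists2 m, A m & exists r, x = m + r * a].
Proof.
move=> idA; have [_ addA mulA] := idA; split.
- by exists 0, 0; [exact: ideal0 | exists 0; rewrite mul0r addr0].
- move=> _ _ [m Am [r ->]] [n An [s ->]].
  by exists (m + n); [exact: addA | exists (r + s); rewrite mulrDl addrACA].
- move=> s _ [m Am [r ->]].
  by exists (s * m); [exact: mulA | exists (s * r); rewrite mulrDr mulrA].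
Qed.

Lemma maximal_ideal_prime (S : comPzSemiRingType) (M : set S) :
  maximal_ideal M -> prime_ideal M.
Proof.
move=> [properM maxM]; split=> // a b Mab; have [idM _] := properM.
have [Ma|nMa] := pselect (M a); [by left | right].
have [_ addM mulM] := idM.
set A := [set x | exists2 m, M m & exists r, x = m + r * a].
have AT : A = setT.
  (* Were [A] proper, maximality would give [A = M], and [a = 0 + 1 * a] would lie in [M]. *)
  apply: contrapT => nAT; apply: nMa; rewrite -(maxM A).
  - by exists 0; [exact: ideal0 | exists 1; rewrite add0r mul1r].
  - by split=> //; exact: ideal_adjoin.
  - by move=> m Mm; exists m => //; exists 0; rewrite mul0r addr0.
have [m Mm [r def1]] : A 1 by rewrite AT.
(* Multiplying [1 = m + r * a] by [b] gives [b = b * m + r * (a * b)], with both terms in [M]. *)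
rewrite -[b]mul1r def1 mulrDl -mulrA [m * b]mulrC.
by apply: addM; exact: mulM.
Qed.

Lemma basic_z_self (S : comPzSemiRingType) (x : S) : basic_z x x.
Proof. by move=> M []. Qed.

Lemma basic_z_z_ideal (S : comPzSemiRingType) (x : S) : z_ideal (basic_z x).
Proof.
(* A maximal ideal containing [x] also contains [y], so it is one of those intersected in
   [basic_z y]. *)
split; last by move=> y xy z yz M [maxM Mx]; apply: yz; split=> //; exact: xy.
split.
- by exists x; exact: basic_z_self.
- move=> a b xa xb M Mx; have [[[[_ addM _] _] _] _] := Mx.
  by apply: addM; [exact: xa | exact: xb].
- move=> s a xa M Mx; have [[[[_ _ mulM] _] _] _] := Mx.
  by apply: mulM; exact: xa.
Qed.

Lemma basic_z_mul (S : comPzSemiRingType) (a b x y : S) :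
  basic_z a x -> basic_z b y -> basic_z (a * b) (x * y).
Proof.
move=> ax xy M [maxM Mab].
have [[[_ _ mulM] _] primeM] := maximal_ideal_prime maxM.
have [Ma|Mb] := primeM _ _ Mab; last by apply: mulM; exact: xy.
by rewrite mulrC; apply: mulM; exact: ax.
Qed.

Theorem proposition4p5 (S : comPzSemiRingType) (hS : bzi_semiring S)
    (P : set S) (hP : is_ideal P) :
  z_prime P <-> (z_ideal P /\ prime_ideal P).
Proof.
split=> [[zP nPT primeP]|[zP [[_ nPT] primeP]]].
- split=> //; split=> // a b Pab.
  have [|aP|bP] := primeP _ _ (basic_z_z_ideal a) (basic_z_z_ideal b).
  (* As [P] is an ideal, it is enough to place the generators [x * y] in it; they lie in
     [basic_z (a * b)], which the z-ideal [P] contains along with [a * b]. *)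
  + apply: smallest_sub => // _ [x ax [y xy <-]].
    by apply: zP.2 Pab _ _; exact: basic_z_mul.
  + by left; apply: aP; exact: basic_z_self.
  + by right; apply: bP; exact: basic_z_self.
- split=> // A B _ _ ABP.
  (* A single [a] in [A] outside [P] suffices: for each [b] in [B], primality applied to [a * b]
     forces [b] into [P]. *)
  have [|/existsNP[a /not_implyP[Aa nPa]]] := pselect (A `<=` P); first by left.
  right=> b Bb; have [] // := primeP a b.
  by apply: ABP; apply: sub_gen_smallest; exists a => //; exists b.
Qed.
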